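(* Let Rand-MoWo be the randomized algorithm that, given a preference profile $\succ$, outputs the man-optimal stable matching $\mu_M^*$ of $\succ$ with probability $1/2$ and the woman-optimal stable matching $\mu_W^*$ of $\succ$ with probability $1/2$. Then the distortion of Rand-MoWo is at most $2$.
   Context: Setting (stable matching): there are two disjoint sets of agents, men $M=\{m_1,\dots,m_n\}$ and women $W=\{w_1,\dots,w_n\}$. Every agent $a$ has a valuation function $v_a$ assigning a non-negative real value to each agent of the opposite side; $\mathbf{v}$ denotes the profile of all valuation functions (no normalization is imposed). A preference profile $\succ$ consists of a strict ranking $\succ_a$ of the opposite side for each agent $a$. It is consistent with (induced by) $\mathbf{v}$ if $b\succ_a b'$ implies $v_a(b)\ge v_a(b')$ (ties in values are broken arbitrarily to get strict rankings). A matching $\mu$ is a perfect one-to-one matching of $M$ and $W$; $\mu(a)$ is the partner of $a$. A pair $(m,w)$ is blocking for $\mu$ if $w\succ_m\mu(m)$ and $m\succ_w\mu(w)$. $\mu$ is stable if it has no blocking pair. $\mathcal{M}_s(\succ)$ is the set of stable matchings of $\succ$. The social welfare is $\mathrm{SW}(\mu\mid\mathbf{v})=\sum_{a\in M\cup W}v_a(\mu(a))$; for a randomized matching $\mathrm{SW}$ denotes the expected social welfare. Agents $a,b$ of opposite sides are stable partners if they are matched in some stable matching. The man-optimal (resp. woman-optimal) stable matching is the stable matching in which every man (resp. woman) is matched to the one he (resp. she) ranks highest among all his (resp. her) stable partners; both exist and are computed by the men-proposing (resp. women-proposing) Deferred Acceptance algorithm of Gale and Shapley. The distortion of an ordinal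 algorithm $\mathcal{A}$ (which sees only $\succ$) is $$\mathrm{dist}(\mathcal{A})=\sup_{n,\mathbf{v}}\frac{\max_{\mu\in\mathcal{M}_s(\succ_{\mathbf{v}})}\mathrm{SW}(\mu\mid\mathbf{v})}{\mathrm{SW}(\mathcal{A}(\succ_{\mathbf{v}})\mid\mathbf{v})},$$ where the supremum is over all $n$, all valuation profiles $\mathbf{v}$ and preference profiles $\succ_{\mathbf{v}}$ consistent with $\mathbf{v}$, with the conventions $c/0=+\infty$ for $c>0$ and $0/0=1$. *)

(* Defs.v *)
From mathcomp Require Import all_boot all_order all_algebra all_fingroup.
From mathcomp Require Import classical_sets reals constructive_ereal ereal.

Set Implicit Arguments.
Unset Strict Implicit.
Unset Printing Implicit Defensive.

Import Order.TTheory GRing.Theory Num.Theory.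

Local Open Scope ring_scope.

(* Men and women are two separate copies of ['I_n]. A strict ranking of the
   opposite side is a permutation sending each agent to its position,
   position 0 being the most preferred. *)
Record profile (n : nat) := Profile {
  mrank : 'I_n -> {perm 'I_n};
  wrank : 'I_n -> {perm 'I_n}
}.

Definition mprefers n (P : profile n) (m w w' : 'I_n) : bool :=
  (mrank P m w < mrank P m w')%N.

Definition wprefers n (P : profile n) (w m m' : 'I_n) : bool :=
  (wrank P w m < wrank P w m')%N.

(* A matching [mu] sends man [m] to his partner [mu m]; the partner of woman
   [w] is [mu^-1 w]. *)
Definition matching (n : nat) := {perm 'I_n}.

Definition husband n (mu : matching n) (w : 'I_n) : 'I_n := (mu^-1)%g w.

Definition blocking n (P : profile n) (mu : matching n) (m w : 'I_n) : bool :=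
  mprefers P m w (mu m) && wprefers P w m (husband mu w).

Definition stable n (P : profile n) (mu : matching n) : bool :=
  [forall m, forall w, ~~ blocking P mu m w].

Definition stable_partners n (P : profile n) (m w : 'I_n) : bool :=
  [exists mu : matching n, stable P mu && (mu m == w)].

Definition man_optimal n (P : profile n) (mu : matching n) : bool :=
  stable P mu &&
  [forall m, forall w,
     (stable_partners P m w && (w != mu m)) ==> mprefers P m (mu m) w].

Definition woman_optimal n (P : profile n) (mu : matching n) : bool :=
  stable P mu &&
  [forall w, forall m,
     (stable_partners P m w && (m != husband mu w)) ==>
       wprefers P w (husband mu w) m].

(* By Gale and Shapley such matchings exist, and rankings being strict they are
   unique: the default value of [odflt] is never used. *)
Definition man_opt n (P : profile n) : matching n :=
  odflt 1%g [pick mu | man_optimal P mu].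

Definition woman_opt n (P : profile n) : matching n :=
  odflt 1%g [pick mu | woman_optimal P mu].

Record valuations (R : realType) (n : nat) := Valuations {
  mval : 'I_n -> 'I_n -> R;
  wval : 'I_n -> 'I_n -> R;
  mval_ge0 : forall m w, 0 <= mval m w;
  wval_ge0 : forall w m, 0 <= wval w m
}.

Definition consistent (R : realType) n (P : profile n) (v : valuations R n) :
  Prop :=
  (forall m w w', mprefers P m w w' -> mval v m w' <= mval v m w) /\
  (forall w m m', wprefers P w m m' -> wval v w m' <= wval v w m).

Definition SW (R : realType) n (v : valuations R n) (mu : matching n) : R :=
  \sum_(m < n) mval v m (mu m) + \sum_(w < n) wval v w (husband mu w).

Record rmatching (R : realType) (n : nat) := RMatching {
  prob : {ffun matching n -> R};
  prob_ge0 : forall mu, 0 <= prob mu;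
  prob_sum1 : \sum_mu prob mu = 1
}.

Definition expected_SW (R : realType) n (v : valuations R n)
  (X : rmatching R n) : R := \sum_mu prob X mu * SW v mu.

Definition ordinal_algorithm (R : realType) :=
  forall n : nat, profile n -> rmatching R n.

(* Welfare is nonnegative, so this is the maximum over the nonempty set of
   stable matchings. *)
Definition max_stable_SW (R : realType) n (P : profile n)
  (v : valuations R n) : R := \big[Num.max/0]_(mu | stable P mu) SW v mu.

(* Quotient of nonnegative reals with c / 0 = +oo for c > 0, and 0 / 0 = 1. *)
Definition welfare_ratio (R : realType) (x y : R) : \bar R :=
  if y != 0 then (x / y)%:E else if x == 0 then 1%E else +oo%E.

(* Instances with n = 0 contribute the ratio 0 / 0 = 1, which does not change
   the supremum. *)
Definition distortion (R : realType) (A : ordinal_algorithm R) : \bar R :=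
  ereal_sup [set r : \bar R |
    exists (n : nat) (v : valuations R n) (P : profile n),
      consistent P v /\
      r = welfare_ratio (max_stable_SW P v) (expected_SW v (A n P))]%classic.

Section FairCoin.
Variables (R : realType) (n : nat) (mu1 mu2 : matching n).

(* If [mu1 = mu2], the two halves add up to 1. *)
Definition coin_prob : {ffun matching n -> R} :=
  [ffun mu => 2^-1 * (mu == mu1)%:R + 2^-1 * (mu == mu2)%:R].

Lemma coin_prob_ge0 mu : 0 <= coin_prob mu.
Proof. by rewrite ffunE addr_ge0// mulr_ge0// invr_ge0. Qed.

Lemma coin_prob_sum1 : \sum_mu coin_prob mu = 1.
Proof.
have sum1 (mu0 : matching n) :
    \sum_(mu : matching n) 2^-1 * (mu == mu0)%:R = 2^-1 :> R.
  rewrite (bigD1 mu0)//= eqxx mulr1 big1 ?addr0// => mu /negPf ->.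
  by rewrite mulr0.
under eq_bigr do rewrite ffunE.
by rewrite big_split/= !sum1 -div1r -splitr.
Qed.

Definition fair_coin : rmatching R n := RMatching coin_prob_ge0 coin_prob_sum1.

End FairCoin.

Definition rand_mowo (R : realType) : ordinal_algorithm R :=
  fun n P => fair_coin R (man_opt P) (woman_opt P).

(* Main.v *)
Require Import Defs.
From mathcomp Require Import all_boot all_order all_algebra all_fingroup.
From mathcomp Require Import classical_sets reals constructive_ereal ereal.

(** In a stable matching no man does better than under the man-optimal one and
    no woman does better than under the woman-optimal one, so its welfare is at
    most the men's welfare of the former plus the women's welfare of the
    latter, hence at most the sum of the two welfares, which is twice the
    expected welfare of the lottery.  That the two extremal matchings exist is
    the Gale-Shapley theorem; the women's version follows by exchanging the
    sides. *)

Set Implicit Arguments.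
Unset Strict Implicit.
Unset Printing Implicit Defensive.

Import Order.TTheory GRing.Theory Num.Theory.

Local Open Scope ring_scope.

Section DeferredAcceptance.
Variables (n : nat) (P : profile n).
Implicit Types (m w : 'I_n) (mu : matching n) (r : {ffun 'I_n -> 'I_n}).

Lemma stable_not_wprefers mu m w : stable P mu -> mprefers P m w (mu m) ->
  wprefers P w m (husband mu w) = false.
Proof.
by move=> /forallP/(_ m)/forallP/(_ w); rewrite /blocking negb_and
  => /orP[/negP//|/negPf].
Qed.

(** A state [r] of deferred acceptance records the position, in the ranking of
    each man, of the woman to whom he currently proposes. *)
Definition proposal r m : 'I_n := ((mrank P m)^-1)%g (r m).

Lemma mrank_proposal r m : mrank P m (proposal r m) = r m.
Proof. by rewrite /proposal permKV. Qed.

(** This invariant gives stability once the proposals form a matching: a woman whom [m] would rather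
    have has already turned him down for someone better. *)
Definition rejections_justified r := forall m w, (mrank P m w < r m)%N ->
  exists2 m', proposal r m' = w & wprefers P w m' m.

(** This invariant gives optimality: no man has yet been rejected by a stable partner. *)
Definition rejections_safe r := forall mu m,
  stable P mu -> (r m <= mrank P m (mu m))%N.

Lemma injective_proposal_man_optimal r : rejections_justified r ->
  rejections_safe r -> injective (proposal r) -> exists mu, man_optimal P mu.
Proof.
move=> Jr Sr inj_r; exists (perm inj_r); apply/andP; split.
  apply/forallP=> m; apply/forallP=> w; apply/negP => /andP[].
  rewrite /mprefers permE mrank_proposal => /Jr[m' <-].
  rewrite /wprefers /husband -[in proposal r m'](permE inj_r) permK => lt1 lt2.
  by have := ltn_trans lt1 lt2; rewrite ltnn.
apply/forallP=> m; apply/forallP=> w; apply/implyP=> /andP[].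
move=> /existsP[mu /andP[/(Sr _ m) + /eqP <-]].
rewrite /mprefers permE mrank_proposal leq_eqVlt => /orP[/eqP eq_r|//].
by case/eqP; apply: (@perm_inj _ (mrank P m)); rewrite mrank_proposal; apply: ord_inj.
Qed.

(** A man rejected by his last choice would leave every woman with a proposal,
    hence, by counting, nobody with two. *)
Lemma rejected_not_last r m1 m2 : rejections_justified r -> m1 != m2 ->
  proposal r m1 = proposal r m2 -> ((r m2).+1 < n)%N.
Proof.
move=> Jr neq12 eq12; rewrite ltnNge; apply/negP=> last_m2.
have surj w : w \in codom (proposal r).
  have [->|neq_w] := eqVneq w (proposal r m2); first exact: codom_f.
  suff /Jr[m' <- _] : (mrank P m2 w < r m2)%N by exact: codom_f.
  rewrite ltn_neqAle -ltnS (leq_trans (ltn_ord _) last_m2) andbT.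
  apply: contra neq_w => /eqP/ord_inj eq_r; apply/eqP.
  by apply: (@perm_inj _ (mrank P m2)); rewrite mrank_proposal.
have /injectiveP inj_r : injectiveb (proposal r).
  rewrite /injectiveb /dinjectiveb; apply/card_uniqP.
  rewrite size_map -cardE; apply: eq_card => w; rewrite inE; exact: surj.
by case/eqP: neq12; exact: inj_r.
Qed.

(** The rejected rival [m2] moves on to his next choice; the sum of positions measures progress. *)
Lemma deferred_acceptance_step r m1 m2 :
  rejections_justified r -> rejections_safe r ->
  proposal r m1 = proposal r m2 -> wprefers P (proposal r m2) m1 m2 ->
  exists r', [/\ rejections_justified r', rejections_safe r' &
    (\sum_m r' m = (\sum_m r m).+1)%N].
Proof.
move=> Jr Sr eq12 pref12.
have neq12 : m1 != m2 by apply: contraTneq pref12 => ->; rewrite /wprefers ltnn.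
have ltn2 := rejected_not_last Jr neq12 eq12.
pose r' : {ffun 'I_n -> 'I_n} :=
  [ffun m => if m == m2 then Ordinal ltn2 else r m].
have r'_m2 : r' m2 = (r m2).+1 :> nat by rewrite ffunE eqxx.
have r'_neq m : m != m2 -> r' m = r m by rewrite ffunE => /negPf ->.
have proposal'_neq m : m != m2 -> proposal r' m = proposal r m.
  by move=> neq_m; rewrite /proposal r'_neq.
exists r'; split.
(* If the witness is [m2], who leaves, then [m1] replaces him: the best offer a woman holds never
   gets worse. *)
- have keep w m m' : proposal r m' = w -> wprefers P w m' m ->
      exists2 m', proposal r' m' = w & wprefers P w m' m.
    have [->|neq_m' <-] := eqVneq m' m2; last by exists m'; rewrite ?proposal'_neq.
    move=> <- pref2; exists m1; first by rewrite proposal'_neq.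
    exact: ltn_trans pref12 pref2.
  move=> m w; have [->|neq_m] := eqVneq m m2; last first.
    by rewrite r'_neq// => /Jr[m' ? ?]; exact: (keep _ _ m').
  rewrite r'_m2 ltnS leq_eqVlt => /orP[/eqP/ord_inj eq_r|].
    have -> : w = proposal r m2.
      by apply: (@perm_inj _ (mrank P m2)); rewrite mrank_proposal.
    by apply: (keep _ _ m1).
  by move=> /Jr[m' ? ?]; exact: (keep _ _ m').
- move=> mu m st_mu; have [->|neq_m] := eqVneq m m2; last by rewrite r'_neq ?Sr.
  rewrite r'_m2 ltn_neqAle Sr// andbT; apply/negP=> /eqP/ord_inj eq_r.
  have mu2 : mu m2 = proposal r m2.
    by apply: (@perm_inj _ (mrank P m2)); rewrite mrank_proposal.
  (* Suppose [mu] gives [m2] the woman rejecting him. By safety [m1] has not passed [mu m1], so he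
     prefers that woman to [mu m1]; she prefers [m1] to [m2], and the two block [mu]. *)
  have : mprefers P m1 (mu m2) (mu m1).
    rewrite /mprefers mu2 -eq12 mrank_proposal ltn_neqAle Sr// andbT.
    apply: contra neq12 => /eqP/ord_inj eq_r1; apply/eqP/(@perm_inj _ mu).
    by rewrite mu2 -eq12; apply: (@perm_inj _ (mrank P m1)); rewrite mrank_proposal.
  by move=> /(stable_not_wprefers st_mu); rewrite /husband permK mu2 pref12.
- rewrite (bigD1 m2)//= r'_m2 [in RHS](bigD1 m2)//= addSn; congr (_ + _).+1%N.
  by apply: eq_bigr => m /r'_neq ->.
Qed.

Lemma deferred_acceptance r : rejections_justified r -> rejections_safe r ->
  exists mu, man_optimal P mu.
Proof.
have [k] := ubnP (n * n - \sum_m r m)%N;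
elim: k r => // k IHk r; rewrite ltnS => lek Jr Sr.
have [/injectiveP|/injectivePn[m1 [m2 neq12 eq12]]] := boolP (injectiveb (proposal r)).
  exact: injective_proposal_man_optimal.
(* The situation is symmetric, and a strict ranking makes the woman prefer one of the two. *)
wlog pref12 : m1 m2 neq12 eq12 / wprefers P (proposal r m2) m1 m2.
  move=> IH; have [|pref21|/ord_inj/perm_inj eq_m] :=
    ltngtP (wrank P (proposal r m2) m1) (wrank P (proposal r m2) m2).
  - exact: IH.
  - by apply: (IH m2 m1); rewrite 1?eq_sym// eq12.
  - by rewrite eq_m eqxx in neq12.
have [r' [Jr' Sr' sum_r']] := deferred_acceptance_step Jr Sr eq12 pref12.
apply: (IHk r') => //; rewrite sum_r'.
(* Truncated subtraction drops strictly only if the old sum is below [n * n], which this bound on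
   the new sum ensures. *)
have : (\sum_m r' m <= n * n)%N.
  rewrite -[X in (_ <= X * _)%N](card_ord n) -sum_nat_const.
  by apply: leq_sum => m _; exact: ltnW.
by rewrite sum_r' => lt_sum; apply: leq_trans lek; exact: ltn_sub2l.
Qed.

Lemma man_optimal_exists : exists mu, man_optimal P mu.
Proof.
(* Position 0 exists in ['I_n] because [m] itself shows that [n] is positive. With all men there,
   both invariants are trivial. *)
pose first m : 'I_n := Ordinal (leq_ltn_trans (leq0n m) (ltn_ord m)).
apply: (@deferred_acceptance [ffun m => first m]) => [m w|mu m _];
  first by rewrite ffunE.
by rewrite ffunE.
Qed.

Lemma man_opt_man_optimal : man_optimal P (man_opt P).
Proof.
rewrite /man_opt; case: pickP => //= none.
by have [mu] := man_optimal_exists; rewrite none.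
Qed.

End DeferredAcceptance.

Definition swap_sides n (P : profile n) : profile n :=
  Profile (wrank P) (mrank P).

(** Inverting the matching merely exchanges the two conjuncts of [blocking]. *)
Lemma stable_swap_sides n (P : profile n) (mu : matching n) :
  stable (swap_sides P) mu = stable P (mu^-1)%g.
Proof.
by apply/idP/idP=> /forallP st; apply/forallP=> a; apply/forallP=> b;
  have /forallP/(_ a) := st b; rewrite /blocking andbC /husband ?invgK.
Qed.

Lemma stable_partners_swap_sides n (P : profile n) (m w : 'I_n) :
  stable_partners (swap_sides P) w m = stable_partners P m w.
Proof.
by apply/existsP/existsP=> -[mu /andP[st /eqP eq_mu]]; exists (mu^-1)%g;
  rewrite ?stable_swap_sides ?invgK -?stable_swap_sides st -eq_mu permK eqxx.
Qed.

Lemma woman_opt_woman_optimal n (P : profile n) :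
  woman_optimal P (woman_opt P).
Proof.
rewrite /woman_opt; case: pickP => //= none.
have [mu /andP[st opt]] := man_optimal_exists (swap_sides P).
have /negP[] := negbT (none (mu^-1)%g).
rewrite /woman_optimal -stable_swap_sides st /husband invgK/=.
apply/forallP=> w; apply/forallP=> m; rewrite -stable_partners_swap_sides.
by move/forallP: opt => /(_ w)/forallP/(_ m).
Qed.

Section Welfare.
Variables (R : realType) (n : nat) (P : profile n) (v : valuations R n).
Hypothesis Pv : consistent P v.
Implicit Types mu : matching n.

Lemma mval_man_opt mu m : stable P mu ->
  mval v m (mu m) <= mval v m (man_opt P m).
Proof.
move=> st; have [->//|neq] := eqVneq (mu m) (man_opt P m).
have /andP[_ /forallP/(_ m)/forallP/(_ (mu m))/implyP opt] := man_opt_man_optimal P.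
apply: Pv.1; apply: opt; rewrite neq andbT.
by apply/existsP; exists mu; rewrite st eqxx.
Qed.

Lemma wval_woman_opt mu w : stable P mu ->
  wval v w (husband mu w) <= wval v w (husband (woman_opt P) w).
Proof.
move=> st; have [->//|neq] := eqVneq (husband mu w) (husband (woman_opt P) w).
have /andP[_ /forallP/(_ w)/forallP/(_ (husband mu w))/implyP opt] :=
  woman_opt_woman_optimal P.
apply: Pv.2; apply: opt; rewrite neq andbT.
by apply/existsP; exists mu; rewrite st /husband permKV eqxx.
Qed.

Lemma SW_ge0 mu : 0 <= SW v mu.
Proof.
by rewrite addr_ge0// sumr_ge0// => a _; rewrite ?mval_ge0 ?wval_ge0.
Qed.

Lemma SW_le_extremal mu : stable P mu ->
  SW v mu <= SW v (man_opt P) + SW v (woman_opt P).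
Proof.
move=> st; apply: lerD.
  apply: (@le_trans _ _ (\sum_(m < n) mval v m (man_opt P m))).
    by apply: ler_sum => m _; exact: mval_man_opt.
  by rewrite lerDl sumr_ge0// => w _; exact: wval_ge0.
apply: (@le_trans _ _ (\sum_(w < n) wval v w (husband (woman_opt P) w))).
  by apply: ler_sum => w _; exact: wval_woman_opt.
by rewrite lerDr sumr_ge0// => m _; exact: mval_ge0.
Qed.

End Welfare.

Lemma expected_SW_fair_coin (R : realType) n (v : valuations R n)
    (mu1 mu2 : matching n) :
  expected_SW v (fair_coin R mu1 mu2) = 2^-1 * (SW v mu1 + SW v mu2).
Proof.
have half (mu0 : matching n) :
    \sum_mu 2^-1 * (mu == mu0)%:R * SW v mu = 2^-1 * SW v mu0.
  rewrite (bigD1 mu0)//= eqxx mulr1 big1 ?addr0// => mu /negPf ->.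
  by rewrite mulr0 mul0r.
rewrite /expected_SW /=; under eq_bigr do rewrite ffunE mulrDl.
by rewrite big_split/= !half -mulrDr.
Qed.

Lemma max_stable_SW_rand_mowo (R : realType) n (P : profile n)
    (v : valuations R n) : consistent P v ->
  max_stable_SW P v <= 2 * expected_SW v (rand_mowo R P).
Proof.
move=> Pv; rewrite expected_SW_fair_coin mulrA divff ?pnatr_eq0// mul1r.
(* The default value 0 of the maximum has to satisfy the bound too. *)
apply/bigmax_leP; split=> [|mu]; first by rewrite addr_ge0 ?SW_ge0.
exact: SW_le_extremal.
Qed.

Lemma max_stable_SW_ge0 (R : realType) n (P : profile n) (v : valuations R n) :
  0 <= max_stable_SW P v.
Proof. exact: bigmax_ge_id. Qed.

(** If [y] is 0, the bound forces [x] to be 0 as well, so the ratio is 1 by convention; hence the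
    hypothesis [1 <= c]. *)
Lemma welfare_ratio_le (R : realType) (x y c : R) : 0 <= x -> 0 <= y ->
  1 <= c -> x <= c * y -> (welfare_ratio x y <= c%:E)%E.
Proof.
move=> x_ge0 y_ge0 c_ge1; rewrite /welfare_ratio; have [->|y_neq0] := eqVneq y 0.
  rewrite mulr0 => x_le0; have -> : x == 0 by rewrite eq_le x_le0.
  by rewrite /= lee_fin.
by rewrite /= lee_fin ler_pdivrMr// lt_def y_neq0.
Qed.

Theorem theorem3p2 (R : realType) : (distortion (rand_mowo R) <= 2%:E)%E.
Proof.
apply: ge_ereal_sup => _ [n [v [P [Pv ->]]]].
apply: welfare_ratio_le; last exact: max_stable_SW_rand_mowo.
- exact: max_stable_SW_ge0.
- by rewrite expected_SW_fair_coin mulr_ge0 ?invr_ge0// addr_ge0 ?SW_ge0.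
- by rewrite ler1n.
Qed.
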